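(* Let $(\mathcal U_1,U_1,V_1)$, $(\mathcal U_2,U_2,V_2)$ be metric $f$-structures and $\phi\colon\mathcal U_1\to\mathcal U_2$ a homomorphism of metric $f$-structures. Let $\mathscr M,\mathscr N$ be $V_1$-normed $U_1$-modules and let $T\in\mathrm{Hom}(\mathscr M,\mathscr N)$. Then there exists a unique homomorphism $\phi_*T\in\mathrm{Hom}(\phi_*\mathscr M,\phi_*\mathscr N)$ such that $$(\phi_*T)(\phi_*v)=\phi_*(Tv)\quad\text{for every }v\in\mathscr M.$$ Moreover, if both $U_1$ and $U_2$ are Dedekind complete, then $|\phi_*T|\le\phi(|T|)$.
   Context: Riesz spaces and $f$-algebras. $\mathbb R^+=[0,\infty)$. A Riesz space is a real vector space $U$ with a partial order that is a lattice and satisfies $u\le v\Rightarrow u+w\le v+w$ and ($u\ge 0$, $\lambda\in\mathbb R^+$) $\Rightarrow\lambda u\ge 0$; $\vee,\wedge$ denote sup and inf of two elements, $u^{+}=u\vee 0$, $u^-=(-u)\vee 0$, $|u|=u\vee(-u)$, $U^+=\{u\in U:u\ge 0\}$. A Riesz subspace is a linear subspace closed under $\vee,\wedge$; a Riesz subspace $V\subset U$ is solid if $v\in U$, $u\in V$, $|v|\le|u|$ imply $v\in V$. A homomorphism of Riesz spaces is a linear map $\phi$ with $\phi(u)\wedge\phi(v)=0$ whenever $u\wedge v=0$. A family is disjoint if $|u|\wedge|v|=0$ for any two different members. Dedekind complete (resp. $\sigma$-complete): every non-empty (resp. countable non-empty) subset bounded above has a supremum and every such subset bounded below has an infimum. An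 $f$-algebra is a Riesz space with an associative, commutative, $\mathbb R$-bilinear multiplication with unit $\mathbf 1_U$ such that $uv\ge0$ for $u,v\ge 0$, and $(uw)\wedge v=0$ whenever $u\wedge v=0$ and $w\ge 0$. An $f$-subalgebra is a Riesz subspace closed under multiplication and containing $\mathbf 1_U$. A homomorphism of $f$-algebras is a multiplicative, unit-preserving homomorphism of Riesz spaces. $\mathrm{Idem}(U)=\{u\in U:u^2=u\}$. A finite partition of $u\in\mathrm{Idem}(U)$ is a finite disjoint family in $\mathrm{Idem}(U)$ with sum $u$; a countable partition of $u$ is a disjoint family $(u_n)_{n\in\mathbb N}\subset\mathrm{Idem}(U)$ with $\sup_n u_n=u$; $\mathcal P(u)$ is the set of countable partitions of $u$. Simple elements: $\mathcal S(U)=\{\sum_{i=1}^n\lambda_iu_i:\lambda_i\in\mathbb R,\ (u_i)_{i=1}^n\text{ a finite partition of }\mathbf 1_U\}$. An order-preserving map is $\sigma$-order-continuous if it preserves existing suprema of non-decreasing sequences and existing infima of non-increasing sequences. A localisable $f$-algebra is a Dedekind $\sigma$-complete $f$-algebra whose multiplication is $\sigma$-order-continuous on $U^+\times U^+$ and such that every $u\in U^+$ is the supremum of a non-decreasing sequence in $\mathcal S(U)\cap U^+$. Metric notions (products of metric spaces carry the sum distance). A metric Riesz space $(U,\mathsf d_U)$ is a Dedekind $\sigma$-complete Riesz space with a complete distance such that $\mathsf d_U(u,0)=\mathsf d_U(|u|,0)$, $\mathsf d_U(u+w,v+w)=\mathsf d_U(u,v)$, and $\mathsf d_U(u,0)\le\mathsf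 d_U(v,0)$ whenever $0\le u\le v$. A metric $f$-algebra is a localisable $f$-algebra $U$ with a distance $\mathsf d_U$ such that $(U,\mathsf d_U)$ is a metric Riesz space, the multiplication $U\times U\to U$ is continuous, $\mathcal S(U)$ is dense, and $\mathsf d_U(\varepsilon\mathbf 1_U,0)\to0$ as $\varepsilon\searrow0$. A metric $f$-structure is a triple $(\mathcal U,U,V)$ where $\mathcal U$ is a localisable $f$-algebra; $(U,\mathsf d_U)$ is a metric $f$-algebra that is a solid $f$-subalgebra of $\mathcal U$; $(V,\mathsf d_V)$ is a metric Riesz space that is a solid Riesz subspace of $\mathcal U$; $UV=V$ (where $UV=\{uv:u\in U,v\in V\}$) and the multiplication $U\times V\to V$ is continuous; and for any $(u_n)_n\in\mathcal P(\mathbf 1_U)$ and $\varepsilon>0$ there is $\delta>0$ such that, whenever $(v_n)_n\subset V^+$ satisfies $\sum_n\mathsf d_V(u_nv_n,0)\le\delta$, the family $(u_nv_n)_n$ is order-bounded in $V$ and $\mathsf d_V(\sup_nu_nv_n,0)\le\varepsilon$. A homomorphism of metric $f$-structures $(\mathcal U_1,U_1,V_1)\to(\mathcal U_2,U_2,V_2)$ is a homomorphism of $f$-algebras $\phi\colon\mathcal U_1\to\mathcal U_2$ such that $\phi|_{U_1}\colon U_1\to U_2$ is a Lipschitz, $\sigma$-order-continuous homomorphism of $f$-algebras and $\phi|_{V_1}\colon V_1\to V_2$ is a Lipschitz homomorphism of Riesz spaces. Modules. A $V$-normed $U$-module over a metric $f$-structure $(\mathcal U,U,V)$ is a $U$-module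 $\mathscr M$ (a real vector space via $\lambda v=(\lambda\mathbf 1_U)\cdot v$) with a map $|\cdot|\colon\mathscr M\to V^+$ such that $|v|=0\iff v=0$, $|v+w|\le|v|+|w|$, $|u\cdot v|=|u||v|$, and the glueing property holds: if $(u_n)_n\in\mathcal P(\mathbf 1_U)$ and $(v_n)_n\subset\mathscr M$ are such that $(|u_n\cdot v_n|)_n$ is order-bounded in $V$ (one writes $(u_n,v_n)_n\in\mathrm{Adm}(\mathscr M)$), then there is a (necessarily unique) $v\in\mathscr M$ with $u_n\cdot v=u_n\cdot v_n$ for all $n$, denoted $\sum_{n\in\mathbb N}u_n\cdot v_n$. $\mathscr M$ has the distance $\mathsf d_{\mathscr M}(v,w)=\mathsf d_V(|v-w|,0)$; if it is complete, $\mathscr M$ is a $V$-Banach $U$-module. For $\varnothing\ne S\subset\mathscr M$, $\mathscr G(S)=\{\sum_nu_n\cdot v_n:(u_n)_n\in\mathcal P(\mathbf 1_U),(v_n)_n\subset S,(u_n,v_n)_n\in\mathrm{Adm}(\mathscr M)\}$. Homomorphisms between $V$-normed $U$-modules. For $V$-normed $U$-modules $\mathscr M,\mathscr N$ over the same metric $f$-structure $(\mathcal U,U,V)$, $\mathrm{Hom}(\mathscr M,\mathscr N)$ is the set of $U$-linear maps $T\colon\mathscr M\to\mathscr N$ for which there is $w\in U^+$ with $|Tv|\le w|v|$ for all $v\in\mathscr M$; when $U$ is Dedekind complete, $|T|:=\inf\{w\in U^+:|Tv|\le w|v|\ \forall v\in\mathscr M\}\in U^+$. Pushforward. For a homomorphism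 $\phi$ of metric $f$-structures as in the claim and a $V_1$-normed $U_1$-module $\mathscr M$, $(\phi_*\mathscr M,\phi_* )$ denotes the couple (existing and unique up to unique isomorphism) of a $V_2$-Banach $U_2$-module $\phi_*\mathscr M$ and a linear map $\phi_*\colon\mathscr M\to\phi_*\mathscr M$ with $|\phi_*v|=\phi(|v|)$ for all $v\in\mathscr M$ and $\mathscr G(\phi_*(\mathscr M))$ dense in $\phi_*\mathscr M$. *)

(* Defs.v *)
From HB Require Import structures.
From mathcomp Require Import all_boot all_order all_algebra.
From mathcomp Require Import all_classical all_reals all_analysis.

Set Implicit Arguments.
Unset Strict Implicit.
Unset Printing Implicit Defensive.

Import Order.TTheory GRing.Theory Num.Theory.
Import numFieldNormedType.Exports.

Local Open Scope classical_set_scope.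
Local Open Scope ring_scope.

Reserved Notation "u `&`^r v" (at level 48, left associativity).
Reserved Notation "u `|`^r v" (at level 52, left associativity).
Reserved Notation "u *^f v" (at level 40, left associativity).

(* In the library the join of ordered types and rings is [numDomainType], that
   of lattices and zmodules is [realDomainType], and that of rings and modules
   is [lalgType], which imposes 1 != 0; Hierarchy Builder does not admit weaker
   joins declared later. Hence the lattice operations of a Riesz space and the
   multiplication of an f-algebra are fields of the mixins below, and [ring_of]
   recovers the library's ring structure of an f-algebra. *)
HB.mixin Record isRiesz (R : realType) U
    of GRing.Lmodule R U & Order.POrder ring_display U := {
  rmeet : U -> U -> U ;
  rjoin : U -> U -> U ;
  le_rmeet : forall u v w : U, (u <= rmeet v w) = (u <= v) && (u <= w) ;
  rjoin_le : forall u v w : U, (rjoin u v <= w) = (u <= w) && (v <= w) ;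
  riesz_leD : forall u v w : U, u <= v -> u + w <= v + w ;
  riesz_scale_ge0 : forall (a : R) (u : U), 0 <= a -> 0 <= u -> 0 <= a *: u
}.

#[short(type="rieszType")]
HB.structure Definition Riesz (R : realType) :=
  {U of isRiesz R U & GRing.Lmodule R U & Order.POrder ring_display U}.

Notation "u `&`^r v" := (rmeet u v) : ring_scope.
Notation "u `|`^r v" := (rjoin u v) : ring_scope.

HB.mixin Record isFAlgebra (R : realType) U of Riesz R U := {
  fone : U ;
  fmul : U -> U -> U ;
  fmulA : associative fmul ;
  fmulC : commutative fmul ;
  fmul1 : left_id fone fmul ;
  fmulDl : left_distributive fmul +%R ;
  fmulZl : forall (a : R) (u v : U), a *: fmul u v = fmul (a *: u) v ;
  fmul_ge0 : forall u v : U, 0 <= u -> 0 <= v -> 0 <= fmul u v ;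
  fmul_disj : forall u v w : U,
    u `&`^r v = 0 -> 0 <= w -> fmul u w `&`^r v = 0
}.

#[short(type="fAlgType")]
HB.structure Definition FAlgebra (R : realType) :=
  {U of isFAlgebra R U & Riesz R U}.

Arguments fone {R s}.
Notation "u *^f v" := (fmul u v) : ring_scope.

Definition ring_of (R : realType) (U : fAlgType R) : Type := U.

HB.instance Definition _ (R : realType) (U : fAlgType R) :=
  GRing.Zmodule.copy (ring_of U) U.

HB.instance Definition _ (R : realType) (U : fAlgType R) :=
  GRing.Zmodule_isComPzRing.Build (ring_of U)
    (@fmulA R U) (@fmulC R U) (@fmul1 R U) (@fmulDl R U).

Section order.

Definition dedekind_complete {d : Order.disp_t} (T : porderType d) :=
  forall A : set T, A !=set0 ->
    (has_ubound A -> supremums A !=set0) /\ (has_lbound A -> infimums A !=set0).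

Definition dedekind_sigma_complete {d : Order.disp_t} (T : porderType d) :=
  forall A : set T, A !=set0 -> countable A ->
    (has_ubound A -> supremums A !=set0) /\ (has_lbound A -> infimums A !=set0).

Definition order_bounded {d : Order.disp_t} {T : porderType d} (x : nat -> T) :=
  exists a b : T, forall n, (a <= x n <= b)%O.

Definition sigma_order_continuous {d d' : Order.disp_t}
    {T : porderType d} {T' : porderType d'} (f : T -> T') :=
  [/\ {homo f : x y / (x <= y)%O},
      forall (x : nat -> T) a, nondecreasing_seq x ->
        supremums (range x) a -> supremums (range (f \o x)) (f a)
    & forall (x : nat -> T) a, nonincreasing_seq x ->
        infimums (range x) a -> infimums (range (f \o x)) (f a)].

End order.

Section riesz.
Context {R : realType}.

Definition rabs {U : rieszType R} (u : U) : U := u `|`^r (- u).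

Definition rdisjoint {U : rieszType R} (u v : U) := rabs u `&`^r rabs v = 0.

Definition riesz_hom {U W : rieszType R} (f : U -> W) :=
  linear f /\ forall u v : U, u `&`^r v = 0 -> f u `&`^r f v = 0.

Definition falg_hom {U W : fAlgType R} (f : U -> W) :=
  [/\ riesz_hom f, f fone = fone & {morph f : u v / u *^f v}].

Definition idempotent_elt {U : fAlgType R} : set U := [set u | u *^f u = u].

Definition finite_partition {U : fAlgType R} (n : nat) (u : U) (p : 'I_n -> U) :=
  [/\ forall i, idempotent_elt (p i), forall i j, i != j -> rdisjoint (p i) (p j)
    & \sum_(i < n) p i = u].

Definition countable_partition {U : fAlgType R} (u : U) (p : nat -> U) :=
  [/\ forall n, idempotent_elt (p n), forall n m, n != m -> rdisjoint (p n) (p m)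
    & supremums (range p) u].

Definition simple_elt {U : fAlgType R} : set U :=
  [set x | exists n (a : 'I_n -> R) (p : 'I_n -> U),
     finite_partition fone p /\ x = \sum_(i < n) a i *: p i].

(* [localisable_mul_sup] and [localisable_mul_inf] say that the multiplication
   U^+ x U^+ -> U^+ is sigma-order-continuous: suprema and infima in the
   product order are computed componentwise, and for sequences of positive
   elements they are the same in U^+ as in U. *)
Record localisable (U : fAlgType R) : Prop := Localisable {
  localisable_dedekind : dedekind_sigma_complete U ;
  localisable_mul_sup : forall (u v : nat -> U) (a b : U),
    (forall n, 0 <= u n) -> (forall n, 0 <= v n) ->
    nondecreasing_seq u -> nondecreasing_seq v ->
    supremums (range u) a -> supremums (range v) b ->
    supremums (range (fun n => u n *^f v n)) (a *^f b) ;
  localisable_mul_inf : forall (u v : nat -> U) (a b : U),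
    (forall n, 0 <= u n) -> (forall n, 0 <= v n) ->
    nonincreasing_seq u -> nonincreasing_seq v ->
    infimums (range u) a -> infimums (range v) b ->
    infimums (range (fun n => u n *^f v n)) (a *^f b) ;
  localisable_simple : forall u : U, 0 <= u ->
    exists s : nat -> U, [/\ forall n, simple_elt (s n) /\ 0 <= s n,
      nondecreasing_seq s & supremums (range s) u]
}.

End riesz.

Record distance (R : realType) (T : choiceType) := Distance {
  dist_fun :> T -> T -> R ;
  distxx : forall x, dist_fun x x = 0 ;
  dist_positivity : forall x y, dist_fun x y = 0 -> x = y ;
  dist_sym : forall x y, dist_fun x y = dist_fun y x ;
  dist_triangle : forall y x z, dist_fun x z <= dist_fun x y + dist_fun y z
}.

(* [T] with the library's metric structure given by [d]. *)
Definition metrized (R : realType) (T : choiceType) (d : distance R T) : Type := T.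

HB.instance Definition _ (R : realType) (T : choiceType) (d : distance R T) :=
  Choice.copy (metrized d) T.

HB.instance Definition _ (R : realType) (T : choiceType) (d : distance R T) :=
  isMetric.Build R (metrized d)
    (distxx d) (@dist_positivity _ _ d) (dist_sym d) (dist_triangle d).

Definition complete_space (T : uniformType) :=
  forall F : set_system T, ProperFilter F -> cauchy F -> exists l : T, F --> l.

Definition dist_lipschitz {R : realType} {T T' : choiceType}
    (d : distance R T) (d' : distance R T') (f : T -> T') :=
  exists L : R, forall x y, d' (f x) (f y) <= L * d x y.

Section metric.
Context {R : realType}.

Record metric_riesz (U : rieszType R) (d : distance R U) : Prop := MetricRiesz {
  metric_riesz_dedekind : dedekind_sigma_complete U ;
  metric_riesz_complete : complete_space (metrized d) ;
  metric_riesz_abs : forall u : U, d u 0 = d (rabs u) 0 ;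
  metric_riesz_translation : forall u v w : U, d (u + w) (v + w) = d u v ;
  metric_riesz_mono : forall u v : U, 0 <= u -> u <= v -> d u 0 <= d v 0
}.

(* The product of two metric spaces has the topology of the sum distance. *)
Record metric_falgebra (U : fAlgType R) (d : distance R U) : Prop :=
  MetricFAlgebra {
  metric_falg_localisable : localisable U ;
  metric_falg_riesz : metric_riesz d ;
  metric_falg_mul : continuous
    (fun p : metrized d * metrized d => fmul p.1 p.2 : metrized d) ;
  metric_falg_dense : dense (simple_elt : set (metrized d)) ;
  metric_falg_unit : (fun e : R => d (e *: fone) 0) @ 0^'+ --> (0 : R)
}.

End metric.

Section solid.
Context {R : realType}.

Record solidSubspace (E : rieszType R) := SolidSubspace {
  solid_set :> set E ;
  solid0 : solid_set 0 ;
  solidD : forall u v, solid_set u -> solid_set v -> solid_set (u + v) ;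
  solidZ : forall (a : R) u, solid_set u -> solid_set (a *: u) ;
  solid_meet : forall u v, solid_set u -> solid_set v -> solid_set (u `&`^r v) ;
  solid_join : forall u v, solid_set u -> solid_set v -> solid_set (u `|`^r v) ;
  solid_le : forall u v, solid_set u -> rabs v <= rabs u -> solid_set v
}.

Record solidSubalgebra (A : fAlgType R) := SolidSubalgebra {
  solid_subspace :> solidSubspace A ;
  solid_one : solid_set solid_subspace fone ;
  solid_mul : forall u v, solid_set solid_subspace u ->
    solid_set solid_subspace v -> solid_set solid_subspace (u *^f v)
}.

End solid.

Section subspace_type.
Context {R : realType} {E : rieszType R} (S : solidSubspace E).

Definition subspace_type : Type := set_type (solid_set S).

HB.instance Definition _ := SubChoice.copy subspace_type (set_type (solid_set S)).

Fact subspace_subsemimod : GRing.subsemimod_closed (mem (solid_set S)).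
Proof.
split; first split.
- by apply/mem_set/solid0.
- by move=> u v /set_mem Su /set_mem Sv; apply/mem_set/solidD.
- by move=> a u /set_mem Su; apply/mem_set/solidZ.
Qed.

HB.instance Definition _ :=
  GRing.SubChoice_isSubLmodule.Build R E _ subspace_type subspace_subsemimod.

HB.instance Definition _ :=
  Order.SubChoice_isSubPOrder.Build ring_display E _ ring_display subspace_type.

Let meet (u v : subspace_type) : subspace_type :=
  Sub (val u `&`^r val v) (mem_set (solid_meet (set_valP u) (set_valP v))).

Let join (u v : subspace_type) : subspace_type :=
  Sub (val u `|`^r val v) (mem_set (solid_join (set_valP u) (set_valP v))).

Let le_meet (u v w : subspace_type) : (u <= meet v w) = (u <= v) && (u <= w).
Proof. by rewrite -!Order.le_val SubK le_rmeet. Qed.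

Let join_le (u v w : subspace_type) : (join u v <= w) = (u <= w) && (v <= w).
Proof. by rewrite -!Order.le_val SubK rjoin_le. Qed.

Let leD (u v w : subspace_type) : u <= v -> u + w <= v + w.
Proof. by rewrite -!Order.le_val !raddfD; apply: riesz_leD. Qed.

Let scale_ge0 (a : R) (u : subspace_type) : 0 <= a -> 0 <= u -> 0 <= a *: u.
Proof. by rewrite -!Order.le_val raddf0 linearZ; apply: riesz_scale_ge0. Qed.

HB.instance Definition _ := isRiesz.Build R subspace_type
  le_meet join_le leD scale_ge0.

Fact val_rmeet (u v : subspace_type) : val (u `&`^r v) = val u `&`^r val v.
Proof. exact: SubK. Qed.

End subspace_type.

Section subalgebra_type.
Context {R : realType} {A : fAlgType R} (S : solidSubalgebra A).

Definition subalgebra_type : Type := subspace_type S.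

HB.instance Definition _ := Riesz.copy subalgebra_type (subspace_type S).
HB.instance Definition _ := GRing.SubLmodule.copy subalgebra_type (subspace_type S).
HB.instance Definition _ := Order.SubPOrder.copy subalgebra_type (subspace_type S).

Let one : subalgebra_type := Sub fone (mem_set (solid_one S)).

Let mul (u v : subalgebra_type) : subalgebra_type :=
  Sub (val u *^f val v) (mem_set (solid_mul (set_valP u) (set_valP v))).

Let val_mul u v : val (mul u v) = val u *^f val v. Proof. exact: SubK. Qed.

Let mulA : associative mul.
Proof. by move=> u v w; apply: val_inj; rewrite !val_mul fmulA. Qed.

Let mulC : commutative mul.
Proof. by move=> u v; apply: val_inj; rewrite !val_mul fmulC. Qed.

Let mul1 : left_id one mul.
Proof. by move=> u; apply: val_inj; rewrite val_mul fmul1. Qed.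

Let mulDl : left_distributive mul +%R.
Proof. by move=> u v w; apply: val_inj; exact: fmulDl. Qed.

Let mulZl (a : R) u v : a *: mul u v = mul (a *: u) v.
Proof. by apply: val_inj; exact: fmulZl. Qed.

Let mul_ge0 (u v : subalgebra_type) : 0 <= u -> 0 <= v -> 0 <= mul u v.
Proof. by move=> u0 v0; exact: (@fmul_ge0 R A (val u) (val v)). Qed.

Let mul_disj (u v w : subalgebra_type) :
  u `&`^r v = 0 -> 0 <= w -> mul u w `&`^r v = 0.
Proof.
move=> uv w0; apply: val_inj; rewrite (val_rmeet (S := S)) val_mul.
apply: fmul_disj; last exact: w0.
by rewrite -(val_rmeet (S := S)) uv.
Qed.

HB.instance Definition _ := isFAlgebra.Build R subalgebra_type
  mulA mulC mul1 mulDl mulZl mul_ge0 mul_disj.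

End subalgebra_type.


(* The product of [u \in U] and [v \in V] as an element of [V]; meaningful when
   [U V] is contained in [V], as is the case in a metric f-structure. *)
Definition mulUV {R : realType} {A : fAlgType R}
    (U : solidSubalgebra A) (V : solidSubspace A)
    (u : subalgebra_type U) (v : subspace_type V) : subspace_type V :=
  insubd 0 (val u *^f val v).

Record metricFStructure (R : realType) := MetricFStructure {
  mfA :> fAlgType R ;
  mfU : solidSubalgebra mfA ;
  mfV : solidSubspace mfA ;
  mf_dU : distance R (subalgebra_type mfU) ;
  mf_dV : distance R (subspace_type mfV) ;
  mfA_localisable : localisable mfA ;
  mfU_metric : metric_falgebra mf_dU ;
  mfV_metric : metric_riesz mf_dV ;
  mf_UV : [set u *^f v | u in solid_set mfU & v in solid_set mfV] = mfV ;
  mf_act_continuous : continuous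
    (fun p : metrized mf_dU * metrized mf_dV => mulUV p.1 p.2 : metrized mf_dV) ;
  mf_sup_small : forall (u : nat -> subalgebra_type mfU) (e : R),
    countable_partition fone u -> 0 < e ->
    exists2 r : R, 0 < r & forall v : nat -> subspace_type mfV,
      (forall n, 0 <= v n) ->
      (\sum_(n <oo) (mf_dV (mulUV (u n) (v n)) 0)%:E <= r%:E)%E ->
      order_bounded (fun n => mulUV (u n) (v n)) /\
      forall s, supremums (range (fun n => mulUV (u n) (v n))) s -> mf_dV s 0 <= e
}.

Definition algU {R : realType} (X : metricFStructure R) : fAlgType R :=
  subalgebra_type (mfU X).

Definition spaceV {R : realType} (X : metricFStructure R) : rieszType R :=
  subspace_type (mfV X).

Definition restrict_set {T T' : Type} {A : set T} {B : set T'} (f : T -> T')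
    (fAB : forall x, A x -> B (f x)) (x : set_type A) : set_type B :=
  exist _ (f (val x)) (mem_set (fAB _ (set_valP x))).

Record mfHom (R : realType) (X Y : metricFStructure R) := MFHom {
  mfhom :> X -> Y ;
  mfhom_falg : falg_hom mfhom ;
  mfhom_subU : forall x, solid_set (mfU X) x -> solid_set (mfU Y) (mfhom x) ;
  mfhom_subV : forall x, solid_set (mfV X) x -> solid_set (mfV Y) (mfhom x) ;
  mfhomU : algU X -> algU Y := restrict_set mfhom_subU ;
  mfhomV : spaceV X -> spaceV Y := restrict_set mfhom_subV ;
  mfhomU_falg : falg_hom mfhomU ;
  mfhomU_lipschitz : dist_lipschitz (mf_dU X) (mf_dU Y) mfhomU ;
  mfhomU_sigma : sigma_order_continuous mfhomU ;
  mfhomV_riesz : riesz_hom mfhomV ;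
  mfhomV_lipschitz : dist_lipschitz (mf_dV X) (mf_dV Y) mfhomV
}.

Record vnormedModule (R : realType) (X : metricFStructure R) := VNormedModule {
  nm_module :> lmodType (ring_of (algU X)) ;
  nm_norm : nm_module -> spaceV X ;
  nm_norm_ge0 : forall v, 0 <= nm_norm v ;
  nm_norm_eq0 : forall v, nm_norm v = 0 <-> v = 0 ;
  nm_normD : forall v w, nm_norm (v + w) <= nm_norm v + nm_norm w ;
  nm_normZ : forall (u : ring_of (algU X)) (v : nm_module),
    nm_norm (u *: v) = mulUV (rabs (u : algU X)) (nm_norm v) ;
  nm_glueing : forall (u : nat -> ring_of (algU X)) (v : nat -> nm_module),
    countable_partition (fone : algU X) u ->
    order_bounded (fun n => nm_norm (u n *: v n)) ->
    exists w : nm_module, forall n, u n *: w = u n *: v n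
}.

Section module_distance.
Context {R : realType} {X : metricFStructure R} (M : vnormedModule X).

Let d (v w : M) : R := mf_dV X (nm_norm (v - w)) 0.

Let dxx v : d v v = 0.
Proof. by rewrite /d subrr (nm_norm_eq0 0).2// distxx. Qed.

Let d_positivity v w : d v w = 0 -> v = w.
Proof.
by move/dist_positivity/nm_norm_eq0/eqP; rewrite subr_eq0 => /eqP.
Qed.

Let rabsN (u : algU X) : rabs (- u) = rabs u.
Proof.
rewrite /rabs opprK; apply/le_anti.
by have := lexx (rabs u); have := lexx (rabs (- u));
  rewrite /rabs opprK !rjoin_le => /andP[-> ->] /andP[-> ->].
Qed.

Let normN (v : M) : nm_norm (- v) = nm_norm v.
Proof. by rewrite -scaleN1r nm_normZ rabsN -nm_normZ scale1r. Qed.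

Let d_sym v w : d v w = d w v.
Proof. by rewrite /d -normN opprB. Qed.

Let d_triangle w v z : d v z <= d v w + d w z.
Proof.
have mV := mfV_metric X.
rewrite {1}/d -(subrKA w v (- z)).
apply: le_trans (metric_riesz_mono mV (nm_norm_ge0 _) (nm_normD _ _)) _.
apply: le_trans (dist_triangle _ (nm_norm (w - z)) _ _) _.
have := metric_riesz_translation mV (nm_norm (v - w)) 0 (nm_norm (w - z)).
by rewrite add0r => ->.
Qed.

Definition module_dist : distance R M :=
  Distance dxx d_positivity d_sym d_triangle.

Definition banach := complete_space (metrized module_dist).

Definition glueing_set (S : set M) : set M :=
  [set w | exists (u : nat -> ring_of (algU X)) (v : nat -> M),
     [/\ countable_partition (fone : algU X) u, forall n, S (v n),
         order_bounded (fun n => nm_norm (u n *: v n))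
       & forall n, u n *: w = u n *: v n]].

Definition real_scale (a : R) (v : M) : M :=
  (a *: (fone : algU X) : ring_of (algU X)) *: v.

End module_distance.

Section module_hom.
Context {R : realType} {X : metricFStructure R} {M N : vnormedModule X}.

Definition hom_bounds (T : M -> N) : set (algU X) :=
  [set w | 0 <= w /\ forall v, nm_norm (T v) <= mulUV w (nm_norm v)].

Definition module_hom (T : M -> N) := linear T /\ hom_bounds T !=set0.

(* The default value 0 is irrelevant when [algU X] is Dedekind complete and [T]
   satisfies [module_hom]. *)
Definition hom_norm (T : M -> N) : algU X := infimum 0 (hom_bounds T).

End module_hom.

Record module_pushforward {R : realType} {X Y : metricFStructure R} (phi : mfHom X Y)
    {M : vnormedModule X} {P : vnormedModule Y} (p : M -> P) : Prop := ModulePushforward {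
  pushforward_banach : banach P ;
  pushforwardD : {morph p : v w / v + w} ;
  pushforwardZ : forall (a : R) v, p (real_scale a v) = real_scale a (p v) ;
  pushforward_norm : forall v, nm_norm (p v) = mfhomV phi (nm_norm v) ;
  pushforward_dense : dense (glueing_set (range p) : set (metrized (module_dist P)))
}.

(* Main.v *)
Require Import Defs.
From mathcomp Require Import all_boot all_order all_algebra.
From mathcomp Require Import all_classical all_reals all_analysis.

Set Implicit Arguments.
Unset Strict Implicit.
Unset Printing Implicit Defensive.

Import Order.TTheory GRing.Theory Num.Theory.
Import numFieldNormedType.Exports.

Local Open Scope classical_set_scope.
Local Open Scope ring_scope.

(** The extension is determined by a pointwise inequality. Put
    [c = mfhomU phi w] with [w] a bound of [T], and consider on
    [phM] x [phN] the linear relation formed by the pairs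
    [(phiM v, phiN (T v))]. The identity [|phi_* v| = phi |v|] and the
    multiplicativity and positivity of [phi] give [|y'| <= c |x'|] for every pair
    [(x', y')] of this relation, so the only candidate for the value at [x] is a
    [y] with [|y - y'| <= c |x - x'|] for all pairs [(x', y')]; such an [(x, y)] is
    called compatible below.

    Compatible pairs form the graph of the extension ([exists_extension]).
    Inequalities in [V] may be checked on the members of a countable partition of
    the unit ([le_partition]), so compatibility is a local property: if [x] is glued
    from elements [x'_n], the admissible glueing of the [y'_n] is compatible with
    it, and such a pair can be subtracted from any other compatible pair. The glued
    elements being dense, all the rest is approximation: a quantity bounded by
    [c |x - g|], with [g] glued and near [x], vanishes because the action of [U] on
    [V] is continuous. This gives uniqueness of [y], additivity, and, by
    completeness of the target, existence of [y] for every [x].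

    The map so obtained is real-linear with [|S x| <= c |x|]. It is [U]-linear by
    [bounded_linear]: the bound forces it to commute with idempotents, hence with
    simple elements, hence with everything. Uniqueness is [module_hom_uniq]: a
    homomorphism is determined on glued elements by locality and elsewhere by
    density.

    For the inequality between norms, [phi] need not preserve the infimum of an
    uncountable set, so it is not enough that [phi w] bounds the extension for each
    bound [w] of [T]. Instead the infimum [|T|] is itself a bound of [T]
    ([hom_norm_bound]), and the construction applied to [w = |T|] yields an extension
    bounded by [phi |T|]. That [|T v| <= w |v|] passes to the infimum over [w] is the
    order continuity of multiplication ([le_fmul_infimum]), which follows from
    [2 n a <= a a + n n 1] and the Archimedean property. *)

(** * Riesz spaces and f-algebras *)

Section riesz_theory.
Context {R : realType} {E : rieszType R}.
Implicit Types u v w : E.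

Lemma rleD2r w u v : (u + w <= v + w) = (u <= v).
Proof.
apply/idP/idP => [|]; last exact: riesz_leD.
by move/(@riesz_leD R E _ _ (- w)); rewrite !addrK.
Qed.

Lemma rleD2l w u v : (w + u <= w + v) = (u <= v).
Proof. by rewrite ![w + _]addrC rleD2r. Qed.

Lemma rsubr_ge0 u v : (0 <= v - u) = (u <= v).
Proof. by rewrite -(rleD2r u 0) add0r subrK. Qed.

Lemma rsubr_le0 u v : (u - v <= 0) = (u <= v).
Proof. by rewrite -(rleD2r v _ 0) add0r subrK. Qed.

Lemma rleN2 u v : (- u <= - v) = (v <= u).
Proof. by rewrite -[LHS]rsubr_ge0 opprK addrC rsubr_ge0. Qed.

Lemma rlerBlDr u v w : (u - w <= v) = (u <= v + w).
Proof. by rewrite -(rleD2r w (u - w)) subrK. Qed.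

Lemma rlerBrDr u v w : (u <= v - w) = (u + w <= v).
Proof. by rewrite -(rleD2r w u) subrK. Qed.

Lemma rleD u v u' v' : u <= v -> u' <= v' -> u + u' <= v + v'.
Proof. by move=> uv uv'; apply: (@le_trans _ _ (v + u')); rewrite ?rleD2r ?rleD2l. Qed.

Lemma raddr_ge0 u v : 0 <= u -> 0 <= v -> 0 <= u + v.
Proof. by move=> u0 v0; rewrite -[0]addr0; apply: rleD. Qed.

Lemma rleZ2l (a : R) u v : 0 <= a -> u <= v -> a *: u <= a *: v.
Proof. by move=> a0 uv; rewrite -rsubr_ge0 -scalerBr riesz_scale_ge0// rsubr_ge0. Qed.

Lemma rhalfD u : 2^-1 *: (u + u) = u.
Proof.
by rewrite -mulr2n -[u *+ 2]scaler_nat scalerA mulVf ?pnatr_eq0// scale1r.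
Qed.

Lemma rdouble_ge0 u : 0 <= u + u -> 0 <= u.
Proof. by move=> u0; rewrite -(rhalfD u) riesz_scale_ge0// invr_ge0. Qed.

Lemma rdouble_le0 u : u + u <= 0 -> u <= 0.
Proof.
have h : 0 <= 2^-1 :> R by rewrite invr_ge0.
by move/(rleZ2l h); rewrite rhalfD scaler0.
Qed.

Lemma rjoin_lel u v : u <= u `|`^r v.
Proof. by have := lexx (u `|`^r v); rewrite rjoin_le => /andP[]. Qed.

Lemma rjoin_ler u v : v <= u `|`^r v.
Proof. by have := lexx (u `|`^r v); rewrite rjoin_le => /andP[]. Qed.

Lemma rmeet_lel u v : u `&`^r v <= u.
Proof. by have := lexx (u `&`^r v); rewrite le_rmeet => /andP[]. Qed.

Lemma rmeet_ler u v : u `&`^r v <= v.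
Proof. by have := lexx (u `&`^r v); rewrite le_rmeet => /andP[]. Qed.

Lemma rmeetC u v : u `&`^r v = v `&`^r u.
Proof. by apply/le_anti; rewrite !le_rmeet !rmeet_lel !rmeet_ler. Qed.

Lemma rmeet_idPl u v : u <= v -> u `&`^r v = u.
Proof. by move=> uv; apply/le_anti; rewrite rmeet_lel le_rmeet lexx. Qed.

Lemma rmeetDr u v w : (u `&`^r v) + w = (u + w) `&`^r (v + w).
Proof.
apply/le_anti; rewrite le_rmeet !rleD2r rmeet_lel rmeet_ler/=.
by rewrite -rlerBlDr le_rmeet !rlerBlDr rmeet_lel rmeet_ler.
Qed.

Lemma rabs_ge u : u <= rabs u. Proof. exact: rjoin_lel. Qed.

Lemma rabs_geN u : - u <= rabs u. Proof. exact: rjoin_ler. Qed.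

Lemma rabs_ge0 u : 0 <= rabs u.
Proof.
apply: rdouble_ge0; rewrite -{1}(subrr u).
by apply: rleD; [exact: rabs_ge|exact: rabs_geN].
Qed.

Lemma ger0_rabs u : 0 <= u -> rabs u = u.
Proof.
move=> u0; apply/le_anti; rewrite rabs_ge andbT rjoin_le lexx/=.
by apply: (@le_trans _ _ 0) => //; rewrite -(rleN2 0) opprK oppr0 in u0 *.
Qed.

Lemma rabsN u : rabs (- u) = rabs u.
Proof.
by apply/le_anti; rewrite /rabs opprK !rjoin_le !rjoin_lel !rjoin_ler.
Qed.

Definition rpos u := u `|`^r 0.

Lemma rpos_ge0 u : 0 <= rpos u. Proof. exact: rjoin_ler. Qed.

Lemma rpos_ge u : u <= rpos u. Proof. exact: rjoin_lel. Qed.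

Lemma rpos_eq0 u : rpos u = 0 -> u <= 0.
Proof. by move=> <-; exact: rpos_ge. Qed.

Lemma rposBN u : rpos u - rpos (- u) = u.
Proof.
apply/eqP; rewrite subr_eq; apply/eqP/le_anti.
rewrite rjoin_le -{1}(addr0 u) rleD2l rpos_ge0/=.
rewrite -(subrr u) rleD2l rpos_ge/=.
by rewrite -(rleD2l (- u)) addKr rjoin_le -{1}(addr0 (- u)) rleD2l rpos_ge0
   -(addNr u) rleD2l rpos_ge.
Qed.

Lemma rpos_disj u : rpos u `&`^r rpos (- u) = 0.
Proof.
rewrite -[X in X `&`^r _](subrK (rpos (- u))) rposBN -{2}(add0r (rpos (- u))).
rewrite -rmeetDr; apply/le_anti/andP; split.
  rewrite -rlerBrDr sub0r -[X in X <= _]opprK rleN2 rjoin_le rleN2 rmeet_lel/=.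
  by rewrite -[X in X <= _]oppr0 rleN2 rmeet_ler.
rewrite -rlerBlDr sub0r le_rmeet -[X in _ && (_ <= X)]oppr0 rleN2 rpos_ge0 andbT.
by rewrite -[X in _ <= X]opprK rleN2 rpos_ge.
Qed.

End riesz_theory.

Section falgebra_theory.
Context {R : realType} {A : fAlgType R}.
Implicit Types u v w e : A.

Lemma fmulr1 u : u *^f fone = u. Proof. by rewrite fmulC fmul1. Qed.

Lemma fmulDr u v w : u *^f (v + w) = u *^f v + u *^f w.
Proof. exact: (@mulrDr (ring_of A)). Qed.

Lemma fmulBr u v w : u *^f (v - w) = u *^f v - u *^f w.
Proof. exact: (@mulrBr (ring_of A)). Qed.

Lemma fmulBl u v w : (u - v) *^f w = u *^f w - v *^f w.
Proof. exact: (@mulrBl (ring_of A)). Qed.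

Lemma fmul0l u : 0 *^f u = 0. Proof. exact: (@mul0r (ring_of A)). Qed.

Lemma fmul0r u : u *^f 0 = 0. Proof. exact: (@mulr0 (ring_of A)). Qed.

Lemma fmulZr (a : R) u v : u *^f (a *: v) = a *: (u *^f v).
Proof. by rewrite fmulC -fmulZl fmulC. Qed.

Lemma fmul_lel w u v : 0 <= w -> u <= v -> w *^f u <= w *^f v.
Proof. by move=> w0 uv; rewrite -rsubr_ge0 -fmulBr fmul_ge0// rsubr_ge0. Qed.

Lemma fmul_ler w u v : 0 <= w -> u <= v -> u *^f w <= v *^f w.
Proof. by move=> w0 uv; rewrite ![_ *^f w]fmulC fmul_lel. Qed.

Lemma fmul_disjl w u v : u `&`^r v = 0 -> 0 <= w -> (w *^f u) `&`^r v = 0.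
Proof. by rewrite fmulC; exact: fmul_disj. Qed.

Lemma fmul_disj2 w u v : u `&`^r v = 0 -> 0 <= w ->
  (w *^f u) `&`^r (w *^f v) = 0.
Proof.
move=> uv0 w0; rewrite rmeetC; apply: fmul_disjl => //.
by rewrite rmeetC; exact: fmul_disjl.
Qed.

(** Multiplying the two members of [u `&`^r v = 0] by [v] and by [u] respectively
    shows that [u *^f v] is disjoint from itself. *)
Lemma fmul_disj0 u v : u `&`^r v = 0 -> u *^f v = 0.
Proof.
move=> uv0; have u0 : 0 <= u by rewrite -uv0 rmeet_lel.
have v0 : 0 <= v by rewrite -uv0 rmeet_ler.
have := fmul_disjl uv0 v0; rewrite rmeetC => /fmul_disjl/(_ u0).
by rewrite [v *^f u]fmulC rmeet_idPl.
Qed.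

Lemma fsqr_ge0 u : 0 <= u *^f u.
Proof.
have pm : rpos u *^f rpos (- u) = 0 by apply: fmul_disj0; exact: rpos_disj.
rewrite -(rposBN u) fmulBr !fmulBl pm [rpos (- u) *^f rpos u]fmulC pm subr0 sub0r.
by rewrite opprK raddr_ge0// fmul_ge0// rpos_ge0.
Qed.

Lemma fone_ge0 : 0 <= fone :> A. Proof. by rewrite -(fmul1 fone) fsqr_ge0. Qed.

Lemma idempotent_ge0 e : idempotent_elt e -> 0 <= e.
Proof. by move=> <-; exact: fsqr_ge0. Qed.

Lemma idempotentC e : idempotent_elt e -> idempotent_elt (fone - e).
Proof.
by rewrite /idempotent_elt/= => ee; rewrite fmulBl fmul1 fmulBr fmulr1 ee subrr subr0.
Qed.

Lemma idempotent_le1 e : idempotent_elt e -> e <= fone.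
Proof. by move=> /idempotentC/idempotent_ge0; rewrite rsubr_ge0. Qed.

(** [w *^f rpos u] and [w *^f rpos (- u)] are disjoint, and the hypothesis puts the
    former below the latter. *)
Lemma fmul_rpos_le0 w u : 0 <= w -> w *^f u <= 0 -> w *^f rpos u = 0.
Proof.
move=> w0; rewrite -{1}(rposBN u) fmulBr rsubr_le0 => /rmeet_idPl <-.
exact: fmul_disj2 (rpos_disj u) w0.
Qed.

(** The elements [u] and [v] exceed their meet by two disjoint elements, and
    disjointness survives multiplication by [w]. *)
Lemma fmul_rmeet w u v : 0 <= w ->
  (w *^f u) `&`^r (w *^f v) = w *^f (u `&`^r v).
Proof.
move=> w0; set m := u `&`^r v.
have duv : (u - m) `&`^r (v - m) = 0 by rewrite -rmeetDr subrr.
have := fmul_disj2 duv w0; rewrite !fmulBr -rmeetDr => /eqP.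
by rewrite subr_eq0 => /eqP.
Qed.

End falgebra_theory.

(** * Order continuity of multiplication *)

Section infimum_mul.
Context {R : realType}.

Lemma sigma_complete_archimedean {E : rieszType R} (a b : E) :
  dedekind_sigma_complete E -> (forall n : nat, n%:R *: a <= b) -> a <= 0.
Proof.
move=> DE ab; pose S := range (fun n : nat => n%:R *: a).
have S0 : S !=set0 by exists (0%:R *: a), 0%N.
have cS : countable S by exact: sub_countable (card_image_le _ _) (countableP _).
have [|s [ubs les]] := (DE S S0 cS).1; first by exists b => _ [n _ <-].
have : s <= s - a.
  apply: les => _ [n _ <-]; rewrite rlerBrDr.
  by apply: ubs; exists n.+1 => //; rewrite -natr1 scalerDl scale1r.
by rewrite rlerBrDr -{2}(addr0 s) rleD2l.
Qed.

Context {A : fAlgType R}.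

(** This is [(a - k 1)^2 >= 0]. It trades the possibly unbounded [a] for a multiple
    of the unit and a remainder that becomes negligible after division by [k]. *)
Lemma fmul_young (k : R) (a : A) :
  k *: a + k *: a <= a *^f a + (k * k) *: fone.
Proof.
have := fsqr_ge0 (a - k *: fone).
rewrite fmulBr !fmulBl fmulZr fmulr1 -fmulZl fmul1 fmulZr fmulr1 scalerA.
by rewrite opprB addrACA -opprD rsubr_ge0.
Qed.

(** For [w] in [W] and [m] the meet of [w] with a fixed [w0] in [W], the hypothesis
    gives [b - h a <= (m - h) a]. By [fmul_young] the right-hand side, multiplied by
    [2 k], is at most [k k (m - h) + (w0 - h) a a]. As [w] varies the first summand
    has infimum [0], so [2 k (b - h a)] stays below [(w0 - h) a a] for every [k]. *)
Lemma le_fmul_infimum (W : set A) (a b h : A) :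
  dedekind_sigma_complete A -> W !=set0 -> infimums W h -> 0 <= a ->
  (forall w, W w -> b <= w *^f a) -> b <= h *^f a.
Proof.
move=> DA [w0 Ww0] [lbh infh] a0 bW.
pose x0 := w0 - h; pose d := b - h *^f a.
have x00 : 0 <= x0 by rewrite rsubr_ge0 lbh.
suff : d + d <= 0.
  by move/rdouble_le0; rewrite rsubr_le0.
apply: (@sigma_complete_archimedean A _ (x0 *^f (a *^f a)) DA) => -[|n].
  by rewrite scale0r !fmul_ge0.
set k : R := n.+1%:R.
have k0 : 0 < k by rewrite ltr0n.
have kk0 : 0 <= (k * k)^-1 by rewrite invr_ge0 mulr_ge0// ltW.
rewrite -rsubr_le0.
set y := _ - _.
suff : (k * k)^-1 *: y <= 0.
  move=> /(@rleZ2l R A (k * k) _ _ ltac:(by rewrite mulr_ge0// ltW)).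
  by rewrite scaler0 scalerA mulfV ?scale1r// mulf_neq0 ?gt_eqF.
(* The left-hand side plus [h] is a lower bound of [W], hence at most [h]. *)
rewrite -(rleD2r h) add0r; apply: infh => w Ww.
apply: (@le_trans _ _ (w `&`^r w0)); last exact: rmeet_lel.
set m := w `&`^r w0; pose x := m - h.
have x_ge0 : 0 <= x by rewrite rsubr_ge0 le_rmeet !lbh.
have dx : d <= x *^f a.
  rewrite fmulBl rleD2r [m *^f a]fmulC -fmul_rmeet// le_rmeet.
  by rewrite ![a *^f _]fmulC !bW.
rewrite -rlerBrDr -/x.
suff yx : y <= (k * k) *: x.
  have := @rleZ2l R A _ _ _ kk0 yx.
  by rewrite scalerA mulVf ?scale1r// mulf_neq0// gt_eqF.
rewrite rlerBlDr; apply: (@le_trans _ _ (x *^f (k *: a + k *: a))).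
  rewrite fmulDr fmulZr scalerDr.
  by apply: rleD; apply: rleZ2l => //; exact: ltW.
apply: le_trans (fmul_lel x_ge0 (fmul_young k a)) _.
rewrite fmulDr fmulZr fmulr1 addrC rleD2l fmul_ler ?fsqr_ge0//.
by rewrite rleD2r rmeet_ler.
Qed.

End infimum_mul.

(** * The action of U on V *)

Local Notation "u *' v" := (@mulUV _ _ (mfU _) (mfV _) u v : spaceV _)
  (at level 40, left associativity).

Section action.
Context {R : realType} {X : metricFStructure R}.
Implicit Types (u e : algU X) (v w : spaceV X).

Lemma val_mulUV u v : val (u *' v) = val u *^f val v.
Proof.
rewrite /mulUV val_insubd ifT//; apply: mem_set.
have <- := congr1 (fun S : set X => S (val u *^f val v)) (mf_UV X).
by exists (val u); [exact: set_valP|exists (val v); [exact: set_valP|]].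
Qed.

Lemma le_valU u u' : (val u <= val u' :> X) = (u <= u'). Proof. by []. Qed.

Lemma le_valV v v' : (val v <= val v' :> X) = (v <= v'). Proof. by []. Qed.

Lemma mulUVDr u v w : u *' (v + w) = u *' v + u *' w.
Proof. by apply: val_inj; rewrite raddfD/= !val_mulUV raddfD fmulDr. Qed.

Lemma mulUVDl u u' v : (u + u') *' v = u *' v + u' *' v.
Proof. by apply: val_inj; rewrite raddfD/= !val_mulUV raddfD fmulDl. Qed.

Lemma mulUV0r u : u *' 0 = 0.
Proof. by apply: val_inj; rewrite val_mulUV !raddf0 fmul0r. Qed.

Lemma mulUV0l v : 0 *' v = 0.
Proof. by apply: val_inj; rewrite val_mulUV !raddf0 fmul0l. Qed.

Lemma mulUV1 v : fone *' v = v.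
Proof. by apply: val_inj; rewrite val_mulUV; exact: fmul1. Qed.

Lemma mulUVA u u' v : (u *^f u') *' v = u *' (u' *' v).
Proof. by apply: val_inj; rewrite !val_mulUV fmulA. Qed.

Lemma mulUVCA u u' v : u *' (u' *' v) = u' *' (u *' v).
Proof. by rewrite -!mulUVA fmulC. Qed.

Lemma mulUV_lel u v w : 0 <= u -> v <= w -> u *' v <= u *' w.
Proof. by rewrite -!le_valU -!le_valV !raddf0 !val_mulUV; exact: fmul_lel. Qed.

Lemma mulUV_ler v u u' : 0 <= v -> u <= u' -> u *' v <= u' *' v.
Proof. by rewrite -!le_valU -!le_valV !raddf0 !val_mulUV; exact: fmul_ler. Qed.

End action.

(** * Locality and the distance of V *)

Section locality.
Context {R : realType} {X : metricFStructure R}.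

(** Let [d] be the positive part of [v - w]; every [e n] annihilates it. Then
    [t = inf (d, 1)] is annihilated as well, so that [e n = e n (1 - t) <= 1 - t] for
    all [n]. Since the [e n] have supremum [1], this gives [t = 0], i.e. [d] is
    disjoint from [1] and vanishes. Truncating at [1] puts [t] into [algU X], where
    the supremum is taken. *)
Lemma le_partition (e : nat -> algU X) (v w : spaceV X) :
  countable_partition fone e -> (forall n, e n *' v <= e n *' w) -> v <= w.
Proof.
move=> [ide _ [ub1 sup1]] evw.
pose d : X := rpos (val v - val w).
have ide' n : idempotent_elt (val (e n)) by exact: (congr1 val (ide n)).
have ed0 n : val (e n) *^f d = 0.
  apply: fmul_rpos_le0; first exact: idempotent_ge0.
  by rewrite fmulBr rsubr_le0 -!val_mulUV le_valV.
pose t : X := d `&`^r fone.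
have t0 : 0 <= t by rewrite le_rmeet rpos_ge0 fone_ge0.
have t1 : t <= fone by exact: rmeet_ler.
have Ut : solid_set (mfU X) t.
  apply: (solid_le (solid_one (mfU X))).
  by rewrite !ger0_rabs// fone_ge0.
pose t' : algU X := Sub t (mem_set Ut).
have /sup1 : ubound (range e) (fone - t').
  move=> _ [n _ <-]; rewrite -le_valU raddfB/=.
  have et0 : val (e n) *^f t = 0.
    have e0 := idempotent_ge0 (ide' n); apply/le_anti/andP; split.
      by rewrite -(ed0 n) fmul_lel// rmeet_lel.
    exact: fmul_ge0.
  have -> : val (e n) = val (e n) *^f (fone - t) by rewrite fmulBr et0 subr0 fmulr1.
  rewrite -[X in _ <= X]fmul1 fmul_ler ?rsubr_ge0//.
  exact: idempotent_le1.
rewrite -le_valU raddfB/= => h.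
have t'0 : t = 0.
  apply/le_anti; rewrite t0 andbT -rleN2 oppr0 -(rleD2l fone) addr0.
  exact: h.
have := fmul_disj0 t'0; rewrite fmulr1 => /rpos_eq0.
by rewrite rsubr_le0 le_valV.
Qed.

End locality.

Section metric_theory.
Context {R : realType} {X : metricFStructure R}.
Implicit Types (u : algU X) (v w : spaceV X).

Lemma distance_ge0 {T : choiceType} (d : distance R T) x y : 0 <= d x y.
Proof. exact: (@mdist_ge0 _ (metrized d)). Qed.

Definition magnitude v : R := mf_dV X v 0.

Lemma magnitudeD v w : magnitude (v + w) <= magnitude v + magnitude w.
Proof.
apply: le_trans (dist_triangle _ w _ _) _; rewrite lerD2r /magnitude.
by rewrite -(metric_riesz_translation (mfV_metric X) v 0 w) add0r.
Qed.

Lemma magnitude_abs v : magnitude (rabs v) = magnitude v.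
Proof. by rewrite /magnitude -(metric_riesz_abs (mfV_metric X)). Qed.

Lemma le_magnitude v w : 0 <= v -> v <= w -> magnitude v <= magnitude w.
Proof. exact: metric_riesz_mono (mfV_metric X) _ _. Qed.

(** The positive part of [v] is below [rabs r], so its distance from [0] is
    arbitrarily small. *)
Lemma le0_small v :
  (forall e : R, 0 < e -> exists2 r, v <= r & magnitude r < e) -> v <= 0.
Proof.
move=> small; apply: rpos_eq0; apply: (@dist_positivity _ _ (mf_dV X)).
apply/eqP; rewrite eq_le distance_ge0 andbT.
apply/ler_addgt0Pr => e e0; rewrite add0r.
have [r vr re] := small e e0; apply: ltW; apply: le_lt_trans re.
rewrite -(magnitude_abs r); apply: le_magnitude; first exact: rpos_ge0.
by rewrite rjoin_le rabs_ge0 (le_trans vr)// rabs_ge.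
Qed.

Lemma act_near u0 v0 (e : R) : 0 < e ->
  exists2 r : R, 0 < r & forall u v, mf_dU X u0 u < r -> mf_dV X v0 v < r ->
    mf_dV X (u0 *' v0) (u *' v) < e.
Proof.
move=> e0; have := @mf_act_continuous R X (u0, v0).
move=> /fcvg_ballP/(_ _ e0).
case=> -[/= A B] [/nbhs_ballP[a a0 Aa] /nbhs_ballP[b b0 Bb]] AB.
exists (Num.min a b) => [|u v ua vb]; first by rewrite lt_min a0.
apply: (AB (u, v)); split.
- by apply: Aa; apply: (lt_le_trans ua); rewrite ge_min lexx.
- by apply: Bb; apply: (lt_le_trans vb); rewrite ge_min lexx orbT.
Qed.

Lemma act_small u (e : R) : 0 < e ->
  exists2 r : R, 0 < r & forall v, magnitude v < r -> magnitude (u *' v) < e.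
Proof.
move=> /(act_near u 0)[r r0 near]; exists r => // v vr.
rewrite /magnitude dist_sym -(mulUV0r u).
by apply: near; rewrite ?distxx// dist_sym.
Qed.

Lemma small_act v (e : R) : 0 < e ->
  exists2 r : R, 0 < r & forall u, mf_dU X u 0 < r -> magnitude (u *' v) < e.
Proof.
move=> /(act_near 0 v)[r r0 near]; exists r => // u ur.
rewrite /magnitude dist_sym -(mulUV0l v).
by apply: near; rewrite ?distxx// dist_sym.
Qed.

Lemma dense_dist {T : choiceType} (d : distance R T) (S : set (metrized d)) x e :
  dense S -> 0 < e -> exists2 y : T, S y & d x y < e.
Proof.
move=> dS e0; have [||y [/= yx Sy]] := dS (interior (ball (x : metrized d) e)).
- by exists x; exact: nbhsx_ballx.
- exact: open_interior.
- by exists y => //; have := interior_subset yx.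
Qed.

End metric_theory.

(** * Normed modules *)

Section module_theory.
Context {R : realType} {X : metricFStructure R} {M : vnormedModule X}.
Implicit Types (u e : ring_of (algU X)) (x y z : M).

Lemma nm_norm0 : nm_norm (0 : M) = 0. Proof. exact/nm_norm_eq0. Qed.

Lemma nm_normN x : nm_norm (- x) = nm_norm x.
Proof. by rewrite -scaleN1r nm_normZ rabsN -nm_normZ scale1r. Qed.

Lemma nm_normB x y : nm_norm (x - y) <= nm_norm x + nm_norm y.
Proof. by rewrite -(nm_normN y) nm_normD. Qed.

Lemma nm_norm_subC x y : nm_norm (x - y) = nm_norm (y - x).
Proof. by rewrite -nm_normN opprB. Qed.

Lemma nm_norm_triangle z x y : nm_norm (x - y) <= nm_norm (x - z) + nm_norm (z - y).
Proof. by rewrite -{1}(subrKA z x (- y)) nm_normD. Qed.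

Lemma nm_norm_le0 x : nm_norm x <= 0 -> x = 0.
Proof. by move=> x0; apply/nm_norm_eq0/le_anti; rewrite x0 nm_norm_ge0. Qed.

Lemma nm_normZ_ge0 u x : 0 <= u :> algU X -> nm_norm (u *: x) = u *' nm_norm x.
Proof. by move=> u0; rewrite nm_normZ ger0_rabs. Qed.

Lemma partition_ge0 (e : nat -> algU X) n : countable_partition fone e -> 0 <= e n.
Proof. by case=> ide _ _; exact: idempotent_ge0. Qed.

Lemma real_scaleE (a : R) u x :
  (a *: (u : algU X) : ring_of (algU X)) *: x = real_scale a (u *: x).
Proof.
rewrite /real_scale scalerA; congr (_ *: _).
by rewrite -[in LHS](fmul1 (u : algU X)) fmulZl.
Qed.

Lemma real_scaleA (a b : R) x : real_scale a (real_scale b x) = real_scale (a * b) x.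
Proof. by rewrite -real_scaleE scalerA. Qed.

Lemma real_scale1 x : real_scale 1 x = x.
Proof. by rewrite /real_scale scale1r; exact: (scale1r x). Qed.

Lemma real_scale0 x : real_scale 0 x = 0.
Proof. by rewrite /real_scale scale0r; exact: (scale0r x). Qed.

Lemma nm_norm_small x :
  (forall e : R, 0 < e -> exists2 r, nm_norm x <= r & magnitude r < e) -> x = 0.
Proof. by move=> small; apply: nm_norm_le0; exact: le0_small. Qed.

End module_theory.

Lemma nm_norm_partition {R : realType} {X : metricFStructure R}
    (M N : vnormedModule X) (e : nat -> algU X) (c : algU X)
    (x : M) (y : N) : countable_partition fone e ->
  (forall n, nm_norm ((e n : ring_of _) *: y) <= c *' nm_norm ((e n : ring_of _) *: x)) ->
  nm_norm y <= c *' nm_norm x.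
Proof.
move=> pe H; apply: (le_partition pe) => n; have e0 := partition_ge0 n pe.
by have := H n; rewrite (nm_normZ_ge0 x)// (nm_normZ_ge0 y)// mulUVCA.
Qed.

Section additive_bounded.
Context {R : realType} {X : metricFStructure R} {M N : vnormedModule X}.

(** A real-linear map bounded by [c] commutes with an idempotent [e], since [e]
    kills the values on [(1 - e) M]; hence with simple elements, and with all
    scalars because these are limits of simple ones. *)
Lemma bounded_linear (S : M -> N) (c : algU X) :
  0 <= c -> {morph S : x y / x - y} ->
  (forall (a : R) x, S (real_scale a x) = real_scale a (S x)) ->
  (forall x, nm_norm (S x) <= c *' nm_norm x) -> linear S.
Proof.
move=> c0 SB SZ Sc.
have S0 : S 0 = 0 by rewrite -(subrr 0) SB subrr.
have SD x y : S (x + y) = S x + S y.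
  by rewrite -[y in LHS]opprK SB -[- y]sub0r SB S0 sub0r opprK.
have Sidem0 (e f : ring_of (algU X)) x : 0 <= e :> algU X -> 0 <= f :> algU X ->
    e * f = 0 -> e *: S (f *: x) = 0.
  move=> e0 f0 ef0; apply: nm_norm_le0; rewrite nm_normZ_ge0//.
  apply: le_trans (mulUV_lel e0 (Sc _)) _.
  rewrite nm_normZ_ge0// mulUVCA -[e *' (f *' _)]mulUVA.
  by rewrite (_ : _ *^f _ = 0 :> algU X)// mulUV0l mulUV0r.
have Sidem (e : ring_of (algU X)) x : idempotent_elt (e : algU X) ->
    S (e *: x) = e *: S x.
  move=> ee; have e0 := idempotent_ge0 ee.
  have ec0 := idempotent_ge0 (idempotentC ee).
  have e1 : e * (1 - e) = 0 by rewrite mulrBr mulr1 [e * e]ee subrr.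
  have := Sidem0 _ _ x e0 ec0 e1.
  rewrite scalerBl scale1r SB scalerBr => /eqP; rewrite subr_eq0 => /eqP ->.
  have e1' : (1 - e) * e = 0 by rewrite mulrC.
  have := Sidem0 _ _ x ec0 e0 e1'.
  by rewrite scalerBl scale1r => /eqP; rewrite subr_eq0 => /eqP.
have Ssimple (s : ring_of (algU X)) x : simple_elt (s : algU X) ->
    S (s *: x) = s *: S x.
  move=> [n [a [p [[idp _ _] ->]]]].
  rewrite [X in X *: x](_ : _ = \sum_(i < n) (a i *: p i : ring_of (algU X)))//.
  rewrite !scaler_suml (big_morph S SD S0); apply: eq_bigr => i _.
  by rewrite !real_scaleE SZ Sidem.
move=> u x y; rewrite SD; congr (_ + _).
apply/eqP; rewrite -subr_eq0; apply/eqP/nm_norm_small => e e0.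
have [r r0 small] := small_act (c *' nm_norm x + nm_norm (S x)) e0.
have [s ss us] := dense_dist (u : algU X) (metric_falg_dense (mfU_metric X)) r0.
pose t : ring_of (algU X) := u - s.
exists (rabs (t : algU X) *' (c *' nm_norm x + nm_norm (S x))); last first.
  apply: small; rewrite -(metric_riesz_abs (metric_falg_riesz (mfU_metric X))).
  by rewrite -(metric_riesz_translation (metric_falg_riesz (mfU_metric X)) _ _ s) add0r subrK.
have -> : S (u *: x) - u *: S x = S (t *: x) - t *: S x.
  by rewrite /t scalerBl SB (scalerBl u s (S x)) (Ssimple _ _ ss) opprB addrA subrK.
apply: le_trans (nm_normB _ _) _; rewrite mulUVDr; apply: rleD; last by rewrite nm_normZ.
by apply: le_trans (Sc _) _; rewrite nm_normZ mulUVCA.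
Qed.

End additive_bounded.

(** * Extension of a bounded linear relation *)

Section extension.
Context {R : realType} {X : metricFStructure R} {P Q : vnormedModule X}.
Variables (c : algU X) (D : set P) (G : P -> Q -> Prop).
Hypotheses (c0 : 0 <= c)
  (GB : forall x y x' y', G x y -> G x' y' -> G (x - x') (y - y'))
  (GZ : forall (a : R) x y, G x y -> G (real_scale a x) (real_scale a y))
  (Gc : forall x y, G x y -> nm_norm y <= c *' nm_norm x)
  (GD : forall x, D x -> exists y, G x y)
  (Ddense : dense (glueing_set D : set (metrized (module_dist P))))
  (Qcomplete : banach Q).

(** These are the pairs that the extension can contain if it has the bound [c]. They
    are defined by inequalities against [G] only, and not as limits of glued pairs,
    so that no choice of an approximation or of a partition is involved. *)
Definition compatible (x : P) (y : Q) :=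
  forall x' y', G x' y' -> nm_norm (y - y') <= c *' nm_norm (x - x').

Let G00 : G 0 0.
Proof.
have [g [e [s [_ Ds _ _]]] _] := dense_dist 0 Ddense ltr01.
have [y Gy] := GD (Ds 0%N).
by rewrite -(subrr (s 0%N)) -(subrr y); exact: GB.
Qed.

Let G_compatible x y : G x y -> compatible x y.
Proof. by move=> Gxy x' y' /(GB Gxy)/Gc. Qed.

(** Compatibility is a local property, since an inequality between norms may be
    checked after multiplication by the members of a partition. *)
Let compatible_glue (e : nat -> ring_of (algU X)) (x : nat -> P) (y : nat -> Q) x0 y0 :
  countable_partition (fone : algU X) e -> (forall n, compatible (x n) (y n)) ->
  (forall n, e n *: x0 = e n *: x n) -> (forall n, e n *: y0 = e n *: y n) ->
  compatible x0 y0.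
Proof.
move=> pe cxy ex ey x' y' Gxy'; apply: (nm_norm_partition pe) => n.
have e0 := partition_ge0 n pe.
rewrite !scalerBr ex ey -!scalerBr (nm_normZ_ge0 (y n - y'))//.
by rewrite (nm_normZ_ge0 (x n - x'))// mulUVCA mulUV_lel// cxy.
Qed.

(** Near every [x] there are compatible pairs [(g, z)], glued from pairs of [G],
    that can be subtracted from any compatible pair. *)
Let compatible_near x (r : R) : 0 < r -> exists g z,
  [/\ magnitude (nm_norm (x - g)) < r, compatible g z &
      forall x' y', compatible x' y' -> compatible (x' - g) (y' - z)].
Proof.
move=> r0; have [g [e [s [pe Ds _ eg]]] xg] := dense_dist x Ddense r0.
have /choice[t Gst] : forall n, exists y, G (s n) y by move=> n; exact: GD.
have [z ez] : exists z, forall n, e n *: z = e n *: t n.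
  (* On [e n], [s n] coincides with [g], so [c |g|] dominates the pieces [e n t n]. *)
  apply: (nm_glueing pe); exists 0, (c *' nm_norm g) => n; rewrite nm_norm_ge0/=.
  have e0 := partition_ge0 n pe; have [ide _ _] := pe.
  rewrite (nm_normZ_ge0 (t n))//.
  apply: le_trans (mulUV_lel e0 (Gc (Gst n))) _.
  rewrite mulUVCA mulUV_lel// -(nm_normZ_ge0 (s n))// -eg nm_normZ_ge0//.
  rewrite -[X in _ <= X]mulUV1; apply: mulUV_ler; first exact: nm_norm_ge0.
  exact: idempotent_le1.
exists g, z; split=> //.
  by apply: (compatible_glue pe _ eg ez) => n; exact: G_compatible.
move=> x' y' cxy'.
apply: (@compatible_glue e (fun n => x' - s n) (fun n => y' - t n)) => //.
- move=> n x1 y1 Gxy1; rewrite -!addrA -!opprD.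
  have -> : s n + x1 = s n - (0 - x1) by rewrite sub0r opprK.
  have -> : t n + y1 = t n - (0 - y1) by rewrite sub0r opprK.
  by apply: cxy'; apply: GB => //; exact: GB.
- by move=> n; rewrite !scalerBr eg.
- by move=> n; rewrite !scalerBr ez.
Qed.

Lemma compatible_bound x y : compatible x y -> nm_norm y <= c *' nm_norm x.
Proof. by move=> /(_ _ _ G00); rewrite !subr0. Qed.

Let compatible_approx x y (r : R) : compatible x y -> 0 < r -> exists g z,
  [/\ magnitude (nm_norm (x - g)) < r, compatible g z,
      forall x' y', compatible x' y' -> compatible (x' - g) (y' - z) &
      nm_norm (y - z) <= c *' nm_norm (x - g)].
Proof.
move=> cxy r0; have [g [z [xg cgz sub]]] := compatible_near x r0.
by exists g, z; split=> //; exact: compatible_bound (sub _ _ cxy).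
Qed.

(** Two candidates at [x] both lie within [c |x - g|] of the value at a glued [g]. *)
Lemma compatible_uniq x y y' : compatible x y -> compatible x y' -> y = y'.
Proof.
move=> cxy cxy'; apply/eqP; rewrite -subr_eq0; apply/eqP/nm_norm_small => e e0.
have [r r0 small] := act_small (c + c) e0.
have [g [z [xg cgz sub yz]]] := compatible_approx cxy r0.
exists ((c + c) *' nm_norm (x - g)); last exact: small.
apply: le_trans (nm_norm_triangle z _ _) _.
rewrite mulUVDl; apply: rleD => //; rewrite nm_norm_subC.
exact: compatible_bound (sub _ _ cxy').
Qed.

(** Replacing [(x2, y2)] by a nearby glued pair [(g, z)], which can be subtracted,
    costs an error of at most [2 c |x2 - g|]. *)
Lemma compatibleB x1 y1 x2 y2 :
  compatible x1 y1 -> compatible x2 y2 -> compatible (x1 - x2) (y1 - y2).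
Proof.
move=> cxy1 cxy2 x' y' Gxy'; rewrite -rsubr_le0; apply: le0_small => e e0.
have [r r0 small] := act_small (c + c) e0.
have [g [z [xg cgz sub yz]]] := compatible_approx cxy2 r0.
exists ((c + c) *' nm_norm (x2 - g)); last exact: small.
have -> : y1 - y2 - y' = (y1 - z - y') - (y2 - z).
  by rewrite opprB [y1 - z - y']addrAC subrKA addrAC.
rewrite rlerBlDr; apply: le_trans (nm_normB _ _) _.
rewrite mulUVDl -[X in _ <= X]addrA [X in _ <= X]addrC; apply: rleD => //.
apply: le_trans (sub _ _ cxy1 _ _ Gxy') _; rewrite -mulUVDr; apply: mulUV_lel => //.
have -> : x1 - g - x' = (x2 - g) + (x1 - x2 - x').
  by rewrite [RHS]addrC [x1 - x2 - x']addrAC subrKA addrAC.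
exact: nm_normD.
Qed.

Lemma compatibleZ (a : R) x y :
  compatible x y -> compatible (real_scale a x) (real_scale a y).
Proof.
move=> cxy; have [->|a0] := eqVneq a 0.
  by rewrite !real_scale0; exact: G_compatible.
move=> x' y' Gxy'; have Gxy'' := GZ a^-1 Gxy'.
have K (M : vnormedModule X) (z : M) : real_scale a (real_scale a^-1 z) = z.
  by rewrite real_scaleA mulfV// real_scale1.
rewrite -(K _ x') -(K _ y') /real_scale -!scalerBr !nm_normZ mulUVCA.
by apply: mulUV_lel; [exact: rabs_ge0|exact: cxy].
Qed.

(** The values [z k] at glued elements [g k] converging to [x] satisfy
    [|z k - z l| <= c |g k - g l|]; they form a Cauchy sequence and their limit is
    compatible with [x]. *)
Lemma compatible_exists x : exists y, compatible x y.
Proof.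
have rk k : 0 < k.+1%:R^-1 :> R by rewrite invr_gt0 ltr0n.
have /choice[gz gzP] : forall k : nat, exists gz : P * Q,
    [/\ magnitude (nm_norm (x - gz.1)) < k.+1%:R^-1, compatible gz.1 gz.2 &
      forall x' y', compatible x' y' -> compatible (x' - gz.1) (y' - gz.2)].
  by move=> k; have [g [z H]] := compatible_near x (rk k); exists (g, z).
have near_x (r : R) : 0 < r ->
    \forall k \near \oo, magnitude (nm_norm (x - (gz k).1)) < r.
  move=> r0; near=> k; have [+ _ _] := gzP k; move=> /lt_trans; apply.
  by near: k; exact: (near_infty_natSinv_lt (PosNum r0)).
pose z k : metrized (module_dist Q) := (gz k).2.
have [y zy] : exists y : metrized (module_dist Q), z @ \oo --> y.
  apply: (Qcomplete (fmap_proper_filter z _)); apply: cauchy_exP => e e0.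
  have [r r0 small] := act_small c e0.
  have r20 : 0 < r / 2 by rewrite divr_gt0.
  have [K _ nearK] := near_x _ r20.
  exists (z K), K => // k Kk; rewrite /ball/= /z.
  have [_ cK sub] := gzP k; have [_ cK' _] := gzP K.
  have zK := compatible_bound (sub _ _ cK').
  apply: le_lt_trans (le_magnitude (nm_norm_ge0 _) zK) _; apply: small.
  apply: le_lt_trans (le_magnitude (nm_norm_ge0 _) (nm_norm_triangle x _ _)) _.
  apply: le_lt_trans (magnitudeD _ _) _; rewrite (splitr r) nm_norm_subC.
  by apply: ltrD; apply: nearK => //=.
exists y => x' y' Gxy'; rewrite -rsubr_le0; apply: le0_small => e e0.
have e20 : 0 < e / 2 by rewrite divr_gt0.
have [r r0 small] := act_small c e20.
have nearz : \forall k \near \oo, magnitude (nm_norm (y - z k)) < e / 2.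
  exact: (zy _ (nbhsx_ballx (y : metrized (module_dist Q)) _ e20)).
have [k [yk xk]] : exists k, magnitude (nm_norm (y - z k)) < e / 2 /\
    magnitude (nm_norm (x - (gz k).1)) < r.
  near \oo => k; exists k; split; near: k => //; exact: near_x.
exists (nm_norm (y - z k) + c *' nm_norm (x - (gz k).1)).
  rewrite rlerBlDr -addrA -mulUVDr.
  apply: le_trans (nm_norm_triangle (z k) _ _) _; rewrite rleD2l.
  have [_ ck _] := gzP k; apply: le_trans (ck _ _ Gxy') _; apply: mulUV_lel => //.
  by rewrite [nm_norm (x - (gz k).1)]nm_norm_subC nm_norm_triangle.
apply: le_lt_trans (magnitudeD _ _) _; rewrite (splitr e); apply: ltrD => //.
exact: small.
Unshelve. all: by end_near. Qed.

Lemma exists_extension : exists S : P -> Q, [/\ linear S,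
  forall x, nm_norm (S x) <= c *' nm_norm x & forall x y, G x y -> S x = y].
Proof.
have /choice[S cS] := compatible_exists.
have Sc x : nm_norm (S x) <= c *' nm_norm x by exact: compatible_bound.
exists S; split=> //.
- apply: (bounded_linear c0 _ _ Sc) => [x y|a x].
    by apply: compatible_uniq (cS _) _; exact: compatibleB.
  by apply: compatible_uniq (cS _) _; exact: compatibleZ.
- by move=> x y Gxy; apply: compatible_uniq (cS x) _; exact: G_compatible.
Qed.

End extension.

(** * Homomorphisms of normed modules *)

Section module_hom_theory.
Context {R : realType} {X : metricFStructure R} {M N : vnormedModule X}.
Implicit Types S T : M -> N.

Lemma linear_fun_B T x y : linear T -> T (x - y) = T x - T y.
Proof. by move=> lT; exact: (GRing.zmod_morphism_linear lT). Qed.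

Lemma linear_fun_Z T (u : ring_of (algU X)) x : linear T -> T (u *: x) = u *: T x.
Proof. by move=> lT; exact: (GRing.scalable_linear lT). Qed.

(** Linearity determines both maps on an element [g] glued from [D], and
    [|S x - T x|] is at most [(w + w') |x - g|] for bounds [w] and [w']. *)
Lemma module_hom_uniq (D : set M) S T :
  dense (glueing_set D : set (metrized (module_dist M))) ->
  module_hom S -> module_hom T -> {in D, S =1 T} -> S = T.
Proof.
move=> dD [lS [w [w0 Sw]]] [lT [w' [w'0 Tw']]] ST; apply/funext => x.
apply/eqP; rewrite -subr_eq0; apply/eqP/nm_norm_small => e e0.
have [r r0 small] := act_small (w + w') e0.
have [g [p [s [pp Ds _ pg]]] xg] := dense_dist x dD r0.
have STg : S g = T g.
  apply/eqP; rewrite -subr_eq0; apply/eqP/nm_norm_le0/(le_partition pp) => n.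
  rewrite -nm_normZ_ge0 ?(partition_ge0 n pp)// scalerBr -!linear_fun_Z// pg.
  by rewrite !linear_fun_Z// ST ?mem_set// subrr nm_norm0 mulUV0r.
exists ((w + w') *' nm_norm (x - g)); last exact: small.
apply: le_trans (nm_norm_triangle (S g) _ _) _; rewrite mulUVDl; apply: rleD.
  by rewrite -linear_fun_B.
by rewrite STg nm_norm_subC -linear_fun_B.
Qed.

Lemma hom_bounds_infimums T :
  dedekind_complete (algU X) -> module_hom T -> infimums (hom_bounds T) (hom_norm T).
Proof.
move=> DU [_ Tb]; rewrite /hom_norm /infimum ifF; last exact/negbTE/set0P.
have [s sP] : infimums (hom_bounds T) !=set0.
  by apply: (DU _ Tb).2; exists 0 => w [].
exact: xgetI sP.
Qed.

(** The infimum of the bounds of [T] is a bound because multiplication by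
    [nm_norm v] preserves arbitrary infima. It takes place in the ambient algebra,
    of which [algU X] is a solid part: a lower bound there may be replaced by its
    positive part, which lies in [algU X]. *)
Lemma hom_norm_bound T :
  dedekind_complete (algU X) -> module_hom T -> hom_bounds T (hom_norm T).
Proof.
move=> DU hT; have [lb inf] := hom_bounds_infimums DU hT.
split; first by apply: inf => w [].
move=> v; rewrite -le_valV val_mulUV.
have [_ [w0 Tw0]] := hT.
apply: (@le_fmul_infimum R X (val @` hom_bounds T)).
- exact: localisable_dedekind (mfA_localisable X).
- by exists (val w0), w0.
- split=> [_ [w Tw <-]|z lbz]; first exact: lb.
  have Uz : solid_set (mfU X) (rpos z).
    apply: (solid_le (set_valP w0)); rewrite !ger0_rabs ?rpos_ge0//.
      by rewrite rjoin_le lbz//=; [have [] := Tw0|exists w0].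
    by have [] := Tw0.
  apply: le_trans (rpos_ge z) _.
  apply: (inf (Sub (rpos z) (mem_set Uz))) => w Tw; rewrite -le_valU SubK rjoin_le.
  by rewrite lbz ?andTb; [have [] := Tw|exists w].
- exact: (nm_norm_ge0 v).
- by move=> _ [w [w_ge0 Tw] <-]; rewrite -val_mulUV; exact: Tw.
Qed.

End module_hom_theory.

(** * Pushforward of homomorphisms *)

Section functoriality.
Context {R : realType} {X Y : metricFStructure R} (phi : mfHom X Y).

Lemma riesz_hom_ge0 {E F : rieszType R} (f : E -> F) u :
  riesz_hom f -> 0 <= u -> 0 <= f u.
Proof.
move=> [lf df] u0; have f0 : f 0 = 0.
  by have := GRing.zmod_morphism_linear lf 0 0; rewrite !subrr.
have := df 0 u; rewrite f0 => <-; first exact: rmeet_ler.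
exact: rmeet_idPl.
Qed.

Lemma mfhomU_ge0 (u : algU X) : 0 <= u -> 0 <= mfhomU phi u.
Proof. by apply: riesz_hom_ge0; have [] := mfhomU_falg phi. Qed.

Lemma mfhomV_le (v w : spaceV X) : v <= w -> mfhomV phi v <= mfhomV phi w.
Proof.
have [lV _] := mfhomV_riesz phi; rewrite -[v <= w]rsubr_ge0.
move=> /(riesz_hom_ge0 (mfhomV_riesz phi)).
by rewrite (GRing.zmod_morphism_linear lV) rsubr_ge0.
Qed.

Lemma mfhomV_mulUV (u : algU X) (v : spaceV X) :
  mfhomV phi (u *' v) = mfhomU phi u *' mfhomV phi v.
Proof.
apply: val_inj; rewrite val_mulUV; have [_ _ phiM] := mfhom_falg phi.
by rewrite -[RHS]phiM -val_mulUV.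
Qed.

Lemma pushforward_extension (M N : vnormedModule X) (P Q : vnormedModule Y)
    (p : M -> P) (q : N -> Q) (T : M -> N) (w : algU X) :
  module_pushforward phi p -> module_pushforward phi q -> linear T ->
  hom_bounds T w -> exists S : P -> Q,
  [/\ linear S, hom_bounds S (mfhomU phi w) & forall v, S (p v) = q (T v)].
Proof.
move=> [_ pD pZ pN pdense] [Qc qD qZ qN _] lT [w0 Tw].
have addB (M' : vnormedModule X) (P' : vnormedModule Y) (f : M' -> P') x y :
    {morph f : v w / v + w} -> f (x - y) = f x - f y.
  by move=> fD; apply/eqP; rewrite eq_sym subr_eq -fD subrK.
have := @exists_extension R Y P Q (mfhomU phi w) (range p)
  (fun x y => exists2 v, p v = x & q (T v) = y).
case.
- exact: mfhomU_ge0.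
- move=> _ _ _ _ [v <- <-] [v' <- <-]; exists (v - v'); first exact: addB.
  by rewrite linear_fun_B// addB.
- move=> a _ _ [v <- <-]; exists (real_scale a v); first exact: pZ.
  by rewrite -qZ /real_scale linear_fun_Z.
- by move=> _ _ [v <- <-]; rewrite pN qN -mfhomV_mulUV mfhomV_le.
- by move=> _ [v _ <-]; exists (q (T v)), v.
- exact: pdense.
- exact: Qc.
move=> S [lS Sw Spq]; exists S; split=> //; last by move=> v; apply: Spq; exists v.
by split=> //; exact: mfhomU_ge0.
Qed.

End functoriality.

Theorem corollary3p25 (R : realType) (X1 X2 : metricFStructure R)
    (phi : mfHom X1 X2) (M N : vnormedModule X1) (phM phN : vnormedModule X2)
    (phiM : M -> phM) (phiN : N -> phN) (T : M -> N) :
  module_pushforward phi phiM -> module_pushforward phi phiN -> module_hom T ->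
  (exists! phT : phM -> phN,
     module_hom phT /\ forall v : M, phT (phiM v) = phiN (T v)) /\
  (dedekind_complete (algU X1) -> dedekind_complete (algU X2) ->
   forall phT : phM -> phN,
     module_hom phT -> (forall v : M, phT (phiM v) = phiN (T v)) ->
     hom_norm phT <= mfhomU phi (hom_norm T)).
Proof.
move=> hM hN hT; have [lT [w Tw]] := hT.
have uniq S S' : module_hom S -> (forall v, S (phiM v) = phiN (T v)) ->
    module_hom S' -> (forall v, S' (phiM v) = phiN (T v)) -> S = S'.
  move=> hS ST hS' ST'; apply: (module_hom_uniq (pushforward_dense hM) hS hS').
  by move=> _ /set_mem[v _ <-]; rewrite ST ST'.
split.
  have [S [lS Sw ST]] := pushforward_extension hM hN lT Tw.
  have hS : module_hom S by split=> //; exists (mfhomU phi w).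
  by exists S; split=> // S' [hS' ST']; exact: uniq.
move=> DU1 DU2 S hS ST.
have [S' [lS' S'b ST']] := pushforward_extension hM hN lT (hom_norm_bound DU1 hT).
have [lb _] := hom_bounds_infimums DU2 hS.
apply: lb; rewrite (uniq S S')//; split=> //.
by exists (mfhomU phi (hom_norm T)).
Qed.
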